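(* Let $(\mathscr{L},\vdash)$ be a logical structure. Then the following statements are equivalent. (1) $(\mathscr{L},\vdash)$ is of Tarski-type. (2) There exists a Suszko set for $(\mathscr{L},\vdash)$. (3) For all $\Gamma\cup\{\alpha\}\subseteq\mathscr{L}$ with $\Gamma\nvdash\alpha$, there exists a strongly closed set $\Sigma\supseteq\Gamma$ such that $\Sigma\nvdash\alpha$. (4) For all $\Gamma,\Sigma\subseteq\mathscr{L}$, $\Sigma\subseteq C_{\vdash}(\Gamma)$ if and only if $C_{\vdash}(\Sigma)\subseteq C_{\vdash}(\Gamma)$.
   Context: A logical structure is a pair $(\mathscr{L},\vdash)$ where $\mathscr{L}$ is a nonempty set and $\vdash\subseteq\mathcal{P}(\mathscr{L})\times\mathscr{L}$ is nonempty; write $\Gamma\vdash\alpha$ for $(\Gamma,\alpha)\in\vdash$ and $\Gamma\nvdash\alpha$ otherwise. For $\Gamma\subseteq\mathscr{L}$, $C_\vdash(\Gamma)=\{\alpha\in\mathscr{L}:\Gamma\vdash\alpha\}$. $(\mathscr{L},\vdash)$ is of Tarski-type if it is reflexive ($\alpha\in\Gamma$ implies $\Gamma\vdash\alpha$), monotone ($\Gamma\vdash\alpha$ and $\Gamma\subseteq\Sigma$ imply $\Sigma\vdash\alpha$) and transitive (if $\Gamma\vdash\beta$ for all $\beta\in\Sigma$ and $\Sigma\vdash\alpha$, then $\Gamma\vdash\alpha$). A set $\Gamma\subseteq\mathscr{L}$ is strongly closed if (i) $\Gamma\vdash\alpha$ for every $\alpha\in\Gamma$, and (ii) for every $\alpha\in\mathscr{L}$,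 if there is $\Gamma'\subseteq\Gamma$ with $\Gamma'\vdash\alpha$, then $\alpha\in\Gamma$. A bivaluation is a function $v:\mathscr{L}\to\{0,1\}$; it satisfies $\Gamma$ if $v(\alpha)=1$ for all $\alpha\in\Gamma$. For a set $\mathcal{V}$ of bivaluations, $\Gamma\vdash_{\mathcal{V}}\alpha$ iff every $v\in\mathcal{V}$ satisfying $\Gamma$ has $v(\alpha)=1$. A Suszko set for $(\mathscr{L},\vdash)$ is a nonempty set $\mathcal{V}$ of bivaluations with $\vdash\,=\,\vdash_{\mathcal{V}}$. *)

(* Defs.v *)
From mathcomp Require Import all_boot.
From mathcomp Require Import boolp classical_sets.

Set Implicit Arguments.
Unset Strict Implicit.
Unset Printing Implicit Defensive.

Local Open Scope classical_set_scope.

Record logicalStructure := LogicalStructure {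
  formula :> Type;
  entailment : set (set formula * formula);
  formula_nonempty : [set: formula] !=set0;
  entailment_nonempty : entailment !=set0
}.

Section LogicalStructures.
Variable S : logicalStructure.
Implicit Types (Gamma Sigma : set S) (alpha beta : S).

Definition entails Gamma alpha : Prop := entailment (Gamma, alpha).

Definition consequences Gamma : set S := [set alpha | entails Gamma alpha].

Definition reflexive_structure : Prop :=
  forall Gamma alpha, Gamma alpha -> entails Gamma alpha.

Definition monotone_structure : Prop :=
  forall Gamma Sigma alpha,
    entails Gamma alpha -> Gamma `<=` Sigma -> entails Sigma alpha.

Definition transitive_structure : Prop :=
  forall Gamma Sigma alpha,
    (forall beta, Sigma beta -> entails Gamma beta) ->
    entails Sigma alpha -> entails Gamma alpha.

Definition tarski_type : Prop :=
  [/\ reflexive_structure, monotone_structure & transitive_structure].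

Definition strongly_closed Gamma : Prop :=
  (forall alpha, Gamma alpha -> entails Gamma alpha) /\
  (forall alpha,
     (exists2 Gamma', Gamma' `<=` Gamma & entails Gamma' alpha) ->
     Gamma alpha).

(* The two truth values 0 and 1 are [false] and [true]. *)
Definition bivaluation : Type := S -> bool.

Definition satisfies (v : bivaluation) Gamma : Prop :=
  forall alpha, Gamma alpha -> v alpha = true.

Definition semantic_entailment (V : set bivaluation) : set (set S * S) :=
  [set p | forall v, V v -> satisfies v p.1 -> v p.2 = true].

Definition suszko_set (V : set bivaluation) : Prop :=
  V !=set0 /\ @entailment S = semantic_entailment V.

End LogicalStructures.

(* Main.v *)
(** The characteristic functions of the theories [consequences Gamma] form a
    Suszko set of a Tarski-type structure; conversely, for a valuation [v] of a
    Suszko set, the set of formulas true under [v] is strongly closed. *)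

Require Import Defs.
From mathcomp Require Import all_boot.
From mathcomp Require Import boolp classical_sets.

Local Open Scope classical_set_scope.

Theorem mainTheorem1 (S : logicalStructure) :
  [<-> tarski_type S;
       exists V : set (bivaluation S), suszko_set V;
       forall (Gamma : set S) (alpha : S), ~ entails Gamma alpha ->
         exists Sigma : set S,
           [/\ strongly_closed Sigma, Gamma `<=` Sigma & ~ entails Sigma alpha];
       forall Gamma Sigma : set S,
         Sigma `<=` consequences Gamma <->
         consequences Sigma `<=` consequences Gamma].
Proof.
tfae.
- move=> [refl mono trans].
  pose chi (Gamma : set S) : bivaluation S := fun alpha => `[< entails Gamma alpha >].
  exists (range chi); split.
    by have [[Gamma _] _] := entailment_nonempty S; exists (chi Gamma), Gamma.
  apply/seteqP; split=> -[Gamma alpha] /=.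
    (* [chi Delta] satisfies [Gamma] exactly when [Delta] entails every member of [Gamma]. *)
    move=> Gamma_alpha _ [Delta _ <-] sat; apply/asboolP.
    by apply: trans Gamma_alpha => beta /sat /asboolP.
  move=> sem; apply/asboolP; apply: (sem (chi Gamma)); first by exists Gamma.
  by move=> beta Gamma_beta; apply/asboolP; apply: refl.
- move=> [V [_ entailE]] Gamma alpha.
  rewrite /entails entailE => /existsNP[v /not_implyP[Vv /not_implyP[sat v_alpha]]].
  exists [set beta | v beta = true]; split=> //; last first.
    (* [v] satisfies its own truth set but not [alpha]. *)
    by move=> /(_ v Vv); apply: contra_not v_alpha; apply.
  split=> beta; rewrite /entails entailE; first by move=> v_beta w _; apply.
  by move=> [Gamma' Gamma'v]; apply.
- move=> ext Gamma Sigma; split=> [sub alpha Sigma_alpha | sub beta Sigma_beta].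
    (* Closure of [Delta] absorbs the consequences of [Gamma], hence [Sigma], hence [alpha]; and
       [Delta] entails its own members. *)
    apply: contrapT => /ext[Delta [[refl closed] sub_Delta]]; apply.
    apply/refl/closed; exists Sigma => // beta /sub Gamma_beta.
    by apply: closed; exists Gamma.
  apply: sub; apply: contrapT => /ext[Delta [[refl _] sub_Delta]]; apply.
  exact/refl/sub_Delta.
- move=> galois.
  (* For [Sigma := Gamma] the right side of the equivalence is trivial. *)
  have refl (Gamma : set S) : Gamma `<=` consequences Gamma by apply/galois.
  split=> [Gamma alpha /refl // | Gamma Sigma alpha Gamma_alpha sub |
           Gamma Sigma alpha /(galois Gamma Sigma).1 sub /sub //].
  (* Monotonicity: [Gamma] lies in [Sigma], hence in [consequences Sigma]. *)
  by apply: (galois Sigma Gamma).1 Gamma_alpha; apply: subset_trans sub (refl Sigma).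
Qed.
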